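(* Let $\mathscr{A}=(G,\partial)$ and $\mathscr{A}'=(G,\partial')$ be unicyclizations of a connected graph $G$ such that $\operatorname{im}\partial=\operatorname{im}\partial'$. Let $\beta$ and $\beta'$ be bases of $Z_1(G)$, and let $w_{\mathscr{A}},\lambda_{\mathscr{A}}$ be defined relative to $\beta$ and $w_{\mathscr{A}'},\lambda_{\mathscr{A}'}$ relative to $\beta'$. Then $w_{\mathscr{A}}=\pm w_{\mathscr{A}'}$ (one sign valid for all elements of $Z_1(G)$ simultaneously) and $\lambda_{\mathscr{A}}=\pm\lambda_{\mathscr{A}'}$.
   Context: Graphs are finite and connected; loops and multiple edges are allowed. Fix an orientation of each edge. $\partial_1:\mathbb{Z}^{E(G)}\to\mathbb{Z}^{V(G)}$ is the (oriented) incidence matrix (a loop gives a zero column). $Z_1(G)=\ker\partial_1$ is a free abelian group of rank $m=|E(G)|-|V(G)|+1$; bases are (ordered) $\mathbb{Z}$-bases. A unicyclizer of $G$ is an integer matrix $\partial$ (rows indexed by $E(G)$) with (1) $\ker\partial=0$, (2) $\partial_1\partial=0$, (3) $\operatorname{rk}(\ker\partial_1/\operatorname{im}\partial)=1$. So $\partial$ has $m-1$ linearly independent columns, all in $Z_1(G)$. The pair $\mathscr{A}=(G,\partial)$ is called a unicyclization of $G$; $\operatorname{im}\partial$ is the integral image. For a basis $\beta$ of $Z_1(G)$, $[z]_\beta\in\mathbb{Z}^m$ is the coordinate column vector of $z\in Z_1(G)$, and $[\partial]_\beta$ is the $m\times(m-1)$ matrix whose columns are the coordinate vectors of the columns of $\partial$.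 The winding number map of $\mathscr{A}$ relative to $\beta$ is $w_{\mathscr{A}}:Z_1(G)\to\mathbb{Z}$, $w_{\mathscr{A}}(z)=\det([z]_\beta,[\partial]_\beta)$ (first column $[z]_\beta$). A cycletree of $G$ is a connected spanning subgraph $Y$ of $G$ containing exactly one cycle $C_Y$ (a loop, or a pair of parallel edges, may be that cycle). $\mathcal{U}(G)$ is the set of cycletrees. $z_Y\in Z_1(G)$ is the $\{0,\pm1\}$-vector of $C_Y$ with either orientation chosen. The standard harmonic cycle is $\lambda_{\mathscr{A}}=\sum_{Y\in\mathcal{U}(G)}w_{\mathscr{A}}(z_Y)\cdot z_Y\in Z_1(G)$ (independent of the orientations of the $C_Y$). *)

(* Defs.v *)
From HB Require Import structures.
From mathcomp Require Import all_boot all_order all_algebra.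
From mathcomp Require Import ring.

Set Implicit Arguments.
Unset Strict Implicit.
Unset Printing Implicit Defensive.

Import Order.TTheory GRing.Theory Num.Theory.
Local Open Scope ring_scope.

(* A finite multigraph with every edge oriented from [src] to [tgt]; loops and
   parallel edges are allowed. *)
Record graph := Graph {
  vertex : finType;
  edge : finType;
  src : edge -> vertex;
  tgt : edge -> vertex
}.

(* A spanning subgraph is given by its edge set. *)
Definition adj (G : graph) (S : {set edge G}) : rel (vertex G) :=
  [rel x y | [exists e in S, ((src e == x) && (tgt e == y))
                          || ((src e == y) && (tgt e == x))]].

Definition connected_sub (G : graph) (S : {set edge G}) : bool :=
  (0 < #|vertex G|)%N && [forall x, forall y, connect (adj S) x y].

Definition connected_graph (G : graph) : bool := connected_sub [set: edge G].

(* Rows and columns are indexed by vertices and edges through [enum_val]. *)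
Definition bd1 (G : graph) : 'M[int]_(#|vertex G|, #|edge G|) :=
  \matrix_(v, e) ((enum_val v == tgt (enum_val e))%:R
                - (enum_val v == src (enum_val e))%:R).

Definition is_chain_cycle (G : graph) : pred 'cV[int]_#|edge G| :=
  fun z => bd1 G *m z == 0.

Lemma chain_cycle_zmod_closed (G : graph) : zmod_closed (@is_chain_cycle G).
Proof.
split; first by rewrite unfold_in /is_chain_cycle mulmx0.
move=> x y; rewrite !unfold_in /is_chain_cycle => /eqP hx /eqP hy.
by rewrite mulmxBr hx hy subrr.
Qed.

HB.instance Definition _ (G : graph) :=
  GRing.isZmodClosed.Build _ (@is_chain_cycle G) (@chain_cycle_zmod_closed G).

(* The group Z_1(G). *)
Record Z1 (G : graph) := MkZ1 {
  Z1_val :> 'cV[int]_#|edge G|;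
  _ : Z1_val \in @is_chain_cycle G
}.

HB.instance Definition _ (G : graph) := [isSub for @Z1_val G].
HB.instance Definition _ (G : graph) := [Choice of Z1 G by <:].
HB.instance Definition _ (G : graph) :=
  [SubChoice_isSubZmodule of Z1 G by <:].

Record zbasis (M : zmodType) (r : nat) := ZBasis {
  zbasis_vec : r.-tuple M;
  zbasis_span : forall z : M, exists c : 'cV[int]_r,
    \sum_(i < r) tnth zbasis_vec i *~ c i 0 == z;
  zbasis_free : forall c : 'cV[int]_r,
    \sum_(i < r) tnth zbasis_vec i *~ c i 0 = 0 -> c = 0
}.

Definition zcoord (M : zmodType) (r : nat) (b : zbasis M r) (z : M) :
  'cV[int]_r := xchoose (zbasis_span b z).

Definition in_im (n k : nat) (d : 'M[int]_(n, k)) (z : 'cV[int]_n) : Prop :=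
  exists c : 'cV[int]_k, z = d *m c.

(* The columns of [z] lie in ker a and their classes are Z-linearly independent
   in ker a / im d. *)
Definition indep_in_quotient (l n k p : nat) (a : 'M[int]_(l, n))
    (d : 'M[int]_(n, k)) (z : 'M[int]_(n, p)) : Prop :=
  a *m z = 0 /\ forall c : 'cV[int]_p, in_im d (z *m c) -> c = 0.

(* rk (ker a / im d) = r, the rank of an abelian group being the maximal size
   of a Z-linearly independent family. *)
Definition quotient_rank (l n k : nat) (a : 'M[int]_(l, n))
    (d : 'M[int]_(n, k)) (r : nat) : Prop :=
  (exists z : 'M[int]_(n, r), indep_in_quotient a d z) /\
  (forall (p : nat) (z : 'M[int]_(n, p)),
     indep_in_quotient a d z -> (p <= r)%N).

Record unicyclization (G : graph) := Unicyclization {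
  ncols : nat;
  unicyclizer : 'M[int]_(#|edge G|, ncols);
  unicyclizer_inj : forall c : 'cV[int]_ncols, unicyclizer *m c = 0 -> c = 0;
  bd1_unicyclizer : bd1 G *m unicyclizer = 0;
  unicyclizer_rank : quotient_rank (bd1 G) unicyclizer 1
}.

Lemma unicyclizer_col_cycle (G : graph) (A : unicyclization G)
    (j : 'I_(ncols A)) : col j (unicyclizer A) \in @is_chain_cycle G.
Proof.
by rewrite unfold_in /is_chain_cycle colE mulmxA bd1_unicyclizer mul0mx.
Qed.

Definition unicyclizer_col (G : graph) (A : unicyclization G)
    (j : 'I_(ncols A)) : Z1 G := MkZ1 (unicyclizer_col_cycle j).

Definition zcoord_mx (G : graph) (A : unicyclization G) (r : nat)
    (b : zbasis (Z1 G) r) : 'M[int]_(r, ncols A) :=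
  \matrix_(i, j) zcoord b (unicyclizer_col j) i 0.

Lemma rat_mx_scale m n (K : 'M[rat]_(m, n)) :
  exists2 d : int, d != 0 & exists W : 'M[int]_(m, n),
    map_mx intr W = d%:~R *: K.
Proof.
pose d := \prod_(ij : 'I_m * 'I_n) denq (K ij.1 ij.2).
exists d; first by apply/prodf_neq0 => ij _; exact: denq_neq0.
exists (\matrix_(i, j) (numq (K i j)
  * \prod_(ij | ij != (i, j)) denq (K ij.1 ij.2))).
apply/matrixP => i j.
rewrite !mxE [in RHS]/d [in RHS](bigD1 (i, j)) //=.
rewrite !intrM.
rewrite numqE; ring.
Qed.

Lemma intmx_inj m n :
  injective (map_mx (intr : int -> rat) : 'M_(m,n) -> 'M_(m,n)).
Proof.
move=> X Y /matrixP h; apply/matrixP => i j; have := h i j.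
by rewrite !mxE => /intr_inj.
Qed.

Lemma inj_size n p (M : 'M[int]_(n, p)) :
  (forall c : 'cV[int]_p, M *m c = 0 -> c = 0) -> (p <= n)%N.
Proof.
move=> inj; rewrite leqNgt; apply/negP => lt.
pose MQ : 'M[rat]_(p, n) := (map_mx intr M)^T.
have rk : kermx MQ != 0.
  rewrite -mxrank_eq0 mxrank_ker -lt0n subn_gt0.
  exact: leq_ltn_trans (rank_leq_col _) lt.
have [d d0 [W HW]] := rat_mx_scale (kermx MQ).
have MW : M *m W^T = 0.
  apply: intmx_inj.
  by rewrite map_mxM -map_trmx HW map_mx0 -[LHS]trmxK trmx_mul trmxK -/MQ
     -scalemxAl mulmx_ker scaler0 trmx0.
case/negP: rk; apply/eqP.
have W0 : W = 0.
  apply/row_matrixP => i; rewrite row0 -[LHS]trmxK tr_row.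
  by rewrite [col _ _]inj ?trmx0 // colE mulmxA MW mul0mx.
move: HW; rewrite W0 map_mx0 => /esym/eqP.
rewrite scaler_eq0 intr_eq0 (negbTE d0) /=.
by move/eqP.
Qed.

Lemma gram0 m n (K : 'M[rat]_(m,n)) (c : 'cV[rat]_m) :
  K *m (K^T *m c) = 0 -> K^T *m c = 0.
Proof.
set y := _ *m c => H.
have : y^T *m y = 0 by rewrite trmx_mul trmxK -mulmxA H mulmx0.
move/matrixP/(_ 0 0); rewrite !mxE => /eqP.
rewrite psumr_eq0; last by move=> i _; rewrite !mxE -expr2 sqr_ge0.
move/allP => h; apply/colP => i; have := h i (mem_index_enum _).
by rewrite !mxE mulf_eq0 orbb => /eqP.
Qed.

Lemma zbasis_size (G : graph) (A : unicyclization G) r (b : zbasis (Z1 G) r) :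
  r = (1 + ncols A)%N.
Proof.
pose B : 'M[int]_(#|edge G|, r) :=
  \matrix_(e, i) Z1_val (tnth (zbasis_vec b) i) e 0.
have BE (c : 'cV_r) :
    B *m c = Z1_val (\sum_(i < r) tnth (zbasis_vec b) i *~ c i 0).
  rewrite -[Z1_val _]/(\val _) raddf_sum; apply/colP => e; rewrite !mxE summxE.
  by apply: eq_bigr => i _; rewrite mxE raddfMz /= -scaler_int !mxE intz mulrC.
have Bd : bd1 G *m B = 0.
  apply/matrixP => v i; have /eqP/colP/(_ v) := valP (tnth (zbasis_vec b) i).
  move=> h; apply: etrans (etrans _ h) _.
    rewrite [LHS]mxE [RHS]mxE.
    by apply: eq_bigr => e _; rewrite [B e i]mxE.
  by rewrite !mxE.
have Binj (c : 'cV_r) : B *m c = 0 -> c = 0.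
  by rewrite BE => h; apply: (@zbasis_free _ _ b); apply: val_inj; rewrite /= h.
have Bsurj (z : Z1 G) : B *m zcoord b z = Z1_val z.
  by rewrite BE (eqP (xchooseP (zbasis_span b z))).
pose D := zcoord_mx A b.
have BD : B *m D = unicyclizer A.
  apply/matrixP => e j; have /colP/(_ e) := Bsurj (unicyclizer_col j).
  move=> h; apply: etrans (etrans _ h) _.
    rewrite [LHS]mxE [RHS]mxE.
    by apply: eq_bigr => i _; rewrite [D i j]mxE.
  by rewrite /= mxE.
have [[z [zZ zind]] zmax] := unicyclizer_rank A.
apply/eqP; rewrite eqn_leq; apply/andP; split.
- pose DQ : 'M[rat]_(r, ncols A) := map_mx intr D.
  pose K := row_base (kermx DQ).
  have KD : K *m DQ = 0 by apply/sub_kermxP; rewrite eq_row_base.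
  have Kfree : row_free K by exact: row_base_free.
  have [d d0 [W HW]] := rat_mx_scale K.
  have := zmax _ (B *m W^T).
  have rk : (r <= \rank (kermx DQ) + ncols A)%N.
    rewrite mxrank_ker; by rewrite addnC -leq_subLR leq_sub2l // rank_leq_col.
  move=> H; apply: (leq_trans rk); rewrite leq_add2r; apply: H.
  split; first by rewrite mulmxA Bd mul0mx.
  move=> c [x]; rewrite -BD -!mulmxA => /eqP.
  rewrite -subr_eq0 -mulmxBr => /eqP /Binj /eqP.
  rewrite subr_eq0 => /eqP /(congr1 (map_mx (intr : int -> rat))).
  rewrite !map_mxM -map_trmx HW linearZ /= -scalemxAl => h.
  have : K^T *m map_mx intr c = 0.
    apply: gram0; apply/eqP; have := congr1 (mulmx K) h.
    rewrite -scalemxAr (mulmxA K (map_mx _ D)) KD mul0mx => /eqP.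
    by rewrite scaler_eq0 intr_eq0 (negbTE d0).
  move/(congr1 trmx); rewrite trmx_mul trmxK trmx0 -(mul0mx _ K)
    => /(row_free_inj Kfree).
  move/(congr1 trmx); rewrite trmxK trmx0 => h0; apply: intmx_inj.
  by rewrite h0 map_mx0.
- apply: (@inj_size _ _
    (row_mx (zcoord b (MkZ1 (_ : z \in @is_chain_cycle G))) D)).
    by rewrite unfold_in /is_chain_cycle zZ.
  move=> zc c; rewrite -[c]vsubmxK mul_row_col => h.
  have h2 : z *m usubmx c + unicyclizer A *m dsubmx c = 0.
    by rewrite -BD -[X in X *m usubmx c](Bsurj (MkZ1 zc))
      -!mulmxA -mulmxDr h mulmx0.
  have u0 : usubmx c = 0.
    apply: zind; exists (- dsubmx c).
    by rewrite mulmxN; apply/eqP; rewrite -addr_eq0 h2.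
  rewrite u0 mulmx0 add0r in h2.
  by rewrite u0 (unicyclizer_inj h2) col_mx0.
Qed.

(* Asking for a basis of size [1 + ncols A] is no restriction: by [zbasis_size]
   every basis of Z_1(G) has that size. *)
Definition winding (G : graph) (A : unicyclization G)
    (b : zbasis (Z1 G) (1 + ncols A)) (z : Z1 G) : int :=
  \det (row_mx (zcoord b z) (zcoord_mx A b)).

(* A dart [(e, s)] is the edge [e] traversed along its orientation if
   [s = false] and against it if [s = true]. *)
Definition dart (G : graph) : finType := (edge G * bool)%type.
Definition dsrc (G : graph) (a : dart G) : vertex G :=
  if a.2 then tgt a.1 else src a.1.
Definition dtgt (G : graph) (a : dart G) : vertex G :=
  if a.2 then src a.1 else tgt a.1.

(* A closed walk with distinct vertices and distinct edges: a traversal of a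
   cycle. Distinctness of edges only excludes going back and forth along one
   edge; a loop and a pair of parallel edges are cycles. *)
Definition oriented_cycle (G : graph) (c : seq (dart G)) : bool :=
  [&& c != [::], cycle [rel a b | dtgt a == dsrc b] c,
      uniq [seq dsrc a | a <- c] & uniq [seq a.1 | a <- c]].

Definition cycle_edges (G : graph) (c : seq (dart G)) : {set edge G} :=
  [set e | e \in [seq a.1 | a <- c]].

Definition cycle_vec (G : graph) (c : seq (dart G)) : 'cV[int]_#|edge G| :=
  \col_i \sum_(a <- c | a.1 == enum_val i) (-1) ^+ a.2.

Lemma cycle_vec_Z1 (G : graph) (c : seq (dart G)) : oriented_cycle c ->
  cycle_vec c \in @is_chain_cycle G.
Proof.
case/and4P=> c0 cyc _ _; rewrite unfold_in /is_chain_cycle; apply/eqP.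
have dartE (a : dart G) v :
  \sum_(e < #|edge G|) bd1 G v e * ((a.1 == enum_val e)%:R * (-1) ^+ a.2)
   = (enum_val v == dtgt a)%:R - (enum_val v == dsrc a)%:R.
  rewrite (bigD1 (enum_rank a.1)) //= big1 ?addr0.
    rewrite mxE enum_rankK eqxx mul1r /dtgt /dsrc.
    by case: a.2; rewrite ?mulr1 // mulrN1 opprB.
  move=> i /eqP ne; case: eqP => [h|]; last by rewrite mul0r mulr0.
  by case: ne; rewrite h enum_valK.
apply/colP => v; rewrite !mxE.
transitivity (\sum_(a <- c)
  ((enum_val v == dtgt a)%:R - (enum_val v == dsrc a)%:R : int)).
  rewrite -(eq_bigr _ (fun a _ => dartE a v)) exchange_big /=.
  apply: eq_bigr => e _.
  rewrite [cycle_vec c e 0]mxE big_mkcond -mulr_sumr.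
  congr (_ * _); apply: eq_bigr => a _.
  by case: ifP; rewrite ?mul1r ?mul0r.
rewrite sumrB.
case: c c0 cyc => //= x s _.
set P := path _ _ _ => HP.
have gen : forall y t w,
    path [rel a b : dart G | dtgt a == dsrc b] y (rcons t w) ->
  \sum_(a <- y :: t) ((enum_val v == dtgt a)%:R : int)
    = \sum_(a <- rcons t w) (enum_val v == dsrc a)%:R.
  move=> y t w; elim: t y => [|u t IH] y /=.
    by rewrite andbT !big_seq1 => /eqP ->.
  by case/andP=> /eqP h /IH {}IH; rewrite big_cons IH [RHS]big_cons h.
by rewrite (gen _ _ _ HP) -cats1 big_cat /= big_seq1 big_cons addrC subrr.
Qed.

(* The length bound is harmless, the edges of an oriented cycle being
   distinct. *)
Definition is_cycle (G : graph) (C : {set edge G}) : bool :=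
  [exists c : {bseq #|edge G| of dart G},
     oriented_cycle c && (cycle_edges c == C)].

(* Cycletrees, as edge sets of spanning subgraphs. *)
Definition cycletrees (G : graph) : {set {set edge G}} :=
  [set Y : {set edge G} | connected_sub Y
     && (#|[set C : {set edge G} | is_cycle C && (C \subset Y)]| == 1%N)].

(* [zc Y] is z_Y for an arbitrary choice of one of the two orientations of C_Y,
   for each cycletree Y. *)
Definition orientation_choice (G : graph) (zc : {set edge G} -> Z1 G) : Prop :=
  forall Y : {set edge G}, Y \in cycletrees G ->
    exists c : seq (dart G),
      [/\ oriented_cycle c, cycle_edges c \subset Y
        & Z1_val (zc Y) = cycle_vec c].

Definition harmonic_cycle (G : graph) (A : unicyclization G)
    (b : zbasis (Z1 G) (1 + ncols A)) (zc : {set edge G} -> Z1 G) : Z1 G :=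
  \sum_(Y in cycletrees G) zc Y *~ winding b (zc Y).

(* Main.v *)
Require Import Defs.
From mathcomp Require Import all_boot all_order all_algebra.

Set Implicit Arguments.
Unset Strict Implicit.

Import GRing.Theory.
Local Open Scope ring_scope.

(** Changing the basis of Z_1(G), or the basis of the common image, multiplies
    the matrix ([z], [d]) on the left, respectively on the right, by a fixed
    unimodular matrix, so the winding number changes by a fixed sign.  Each term
    of the harmonic cycle is quadratic in z_Y, and z_Y is determined up to sign:
    conservation at the vertices of a cycle C forces every element of Z_1(G)
    supported on C to be an integer multiple of a traversal of C. *)

(** * Coordinates in a basis of a free abelian group *)

Section Coordinates.

Variables (M : zmodType) (r : nat) (b : zbasis M r).

Lemma zcoordK (z : M) :
  \sum_(i < r) tnth (zbasis_vec b) i *~ zcoord b z i 0 = z.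
Proof. by rewrite (eqP (xchooseP (zbasis_span b z))). Qed.

Lemma zcoord_uniq (z : M) (c : 'cV[int]_r) :
  \sum_(i < r) tnth (zbasis_vec b) i *~ c i 0 = z -> zcoord b z = c.
Proof.
move=> cz; apply/eqP; rewrite -subr_eq0; apply/eqP/(@zbasis_free _ _ b).
under eq_bigr => i _ do rewrite !mxE mulrzBr.
by rewrite sumrB zcoordK cz subrr.
Qed.

Lemma zcoord_comb k (x : 'I_k -> M) (c : 'cV[int]_k) :
  zcoord b (\sum_j x j *~ c j 0) = (\matrix_(i, j) zcoord b (x j) i 0) *m c.
Proof.
apply: zcoord_uniq.
under eq_bigr => i _ do rewrite mxE mulrz_sumr.
rewrite exchange_big /=; apply: eq_bigr => j _.
rewrite -[in RHS](zcoordK (x j)) mulrz_suml.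
by apply: eq_bigr => i _; rewrite mxE mulrzA.
Qed.

Lemma zcoordN (z : M) : zcoord b (- z) = - zcoord b z.
Proof.
apply: zcoord_uniq; rewrite -[in RHS](zcoordK z) -sumrN.
by apply: eq_bigr => i _; rewrite mxE mulrNz.
Qed.

End Coordinates.

(** The transition matrices [P] and [Q] in the two directions are mutually inverse: the coordinates
    of a vector of [b'] in [b'] itself form a unit vector, and passing to [b] and back multiplies
    them by [P *m Q]. *)
Lemma zcoord_change (M : zmodType) r (b b' : zbasis M r) :
  exists2 P : 'M[int]_r, P \in unitmx
    & forall z, zcoord b' z = P *m zcoord b z.
Proof.
have change (b1 b2 : zbasis M r) :
    {P : 'M[int]_r | forall z, zcoord b2 z = P *m zcoord b1 z}.
  exists (\matrix_(i, j) zcoord b2 (tnth (zbasis_vec b1) j) i 0) => z.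
  by rewrite -zcoord_comb zcoordK.
have [P PE] := change b b'; have [Q QE] := change b' b.
exists P => //; apply: (proj1 (mulmx1_unit (B := Q) _)).
apply/matrixP => i j.
have bj : zcoord b' (tnth (zbasis_vec b') j) = delta_mx j 0.
  apply: zcoord_uniq; rewrite (bigD1 j) //= mxE !eqxx big1 ?addr0 // => l /negPf lj.
  by rewrite mxE lj mulr0z.
have /colP/(_ i) := PE (tnth (zbasis_vec b') j).
by rewrite QE bj mulmxA -colE !mxE andbT => <-.
Qed.

(** * Unimodular changes and the sign of the winding number *)

Lemma intr_unit_sign (x : int) : x \is a GRing.unit -> x = 1 \/ x = -1.
Proof. by rewrite unfold_in => /orP[]/eqP; [left | right]. Qed.

(** Each inclusion of images lets one matrix factor through the other, so [U = U *m (Q *m Q')], and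
    injectivity of [U] cancels to [Q *m Q' = 1]. *)
Lemma same_im_unimodular n k (U U' : 'M[int]_(n, k)) :
  (forall c : 'cV[int]_k, U *m c = 0 -> c = 0) ->
  (forall z, in_im U z <-> in_im U' z) ->
  exists2 Q : 'M[int]_k, Q \in unitmx & U' = U *m Q.
Proof.
move=> injU imUU'.
have factor (V V' : 'M[int]_(n, k)) : (forall z, in_im V' z -> in_im V z) ->
    exists Q : 'M[int]_k, V' = V *m Q.
  move=> sub.
  have /fin_all_exists[q qE] (j : 'I_k) : exists c, col j V' = V *m c.
    by apply: sub; exists (delta_mx j 0); rewrite colE.
  exists (\matrix_(i, j) q j i 0); apply/matrixP => i j.
  have /colP/(_ i) := qE j; rewrite !mxE => ->.
  by apply: eq_bigr => l _; rewrite mxE.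
have [Q QE] := factor U U' (fun z => proj2 (imUU' z)).
have [Q' Q'E] := factor U' U (fun z => proj1 (imUU' z)).
exists Q => //; apply: (proj1 (mulmx1_unit (B := Q') _)).
apply/eqP; rewrite -subr_eq0; apply/eqP/matrixP => i j.
have /injU/colP/(_ i) : U *m col j (Q *m Q' - 1%:M) = 0.
  by rewrite colE mulmxA mulmxBr mulmxA -QE -Q'E mulmx1 subrr mul0mx.
by rewrite !mxE.
Qed.

Lemma zcoord_mx_mul (G : graph) (A : unicyclization G) r
    (b : zbasis (Z1 G) r) (c : 'cV[int]_(ncols A)) (z : Z1 G) :
  Z1_val z = unicyclizer A *m c -> zcoord b z = zcoord_mx A b *m c.
Proof.
move=> zE; rewrite -zcoord_comb; congr (zcoord b _).
apply: val_inj; rewrite /= zE -[Z1_val _]/(\val _) raddf_sum.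
apply/colP => e; rewrite !mxE summxE; apply: eq_bigr => j _.
by rewrite raddfMz /= -scaler_int !mxE intz mulrC.
Qed.

Lemma winding_sign (G : graph) (A A' : unicyclization G)
    (b : zbasis (Z1 G) (1 + ncols A)) (b' : zbasis (Z1 G) (1 + ncols A')) :
  (forall z, in_im (unicyclizer A) z <-> in_im (unicyclizer A') z) ->
  (forall z, winding b z = winding b' z) \/
  (forall z, winding b z = - winding b' z).
Proof.
move=> imAA'.
(* The rank of Z_1(G) fixes the number of columns. Eliminating this equality gives both unicyclizers
   the same type and both bases the same size. *)
have /addnI kk' := zbasis_size A b'.
case: A' b' imAA' kk' => k' U' inj' bd' rk' b' /= imAA' kk'.
case: _ / (esym kk') in U' inj' bd' rk' b' imAA' *.
set A' := Unicyclization _ _ _ in b' *.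
have [Q Qu QE] := same_im_unimodular (@unicyclizer_inj _ A) imAA'.
have [P Pu PE] := zcoord_change b b'.
have DE : zcoord_mx A' b' = P *m zcoord_mx A b *m Q.
  apply/matrixP => i j; rewrite mxE PE.
  rewrite (@zcoord_mx_mul _ A _ b (col j Q)) /=; last by rewrite QE colE -mulmxA -colE.
  by rewrite mulmxA colE mulmxA -colE mxE.
(* The column change acts by diag(1, Q), which leaves the first column to [z]; multiplicativity of
   the determinant does the rest. *)
have wE z : winding b' z = \det P * \det Q * winding b z.
  rewrite /winding DE PE.
  have -> : row_mx (P *m zcoord b z) (P *m zcoord_mx A b *m Q) =
      P *m row_mx (zcoord b z) (zcoord_mx A b) *m block_mx 1%:M 0 0 Q.
    by rewrite mul_mx_row mul_row_block !mulmx0 mulmx1 addr0 add0r.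
  by rewrite !det_mulmx det_ublock det1 mul1r mulrAC.
have /intr_unit_sign[s|s] : \det P * \det Q \is a GRing.unit.
- by rewrite unitrM -!unitmxE Pu.
- by left=> z; rewrite wE s mul1r.
- by right=> z; rewrite wE s mulN1r opprK.
Qed.

Lemma windingN (G : graph) (A : unicyclization G)
    (b : zbasis (Z1 G) (1 + ncols A)) (z : Z1 G) :
  winding b (- z) = - winding b z.
Proof.
rewrite /winding zcoordN.
have -> : row_mx (- zcoord b z) (zcoord_mx A b) =
    row_mx (zcoord b z) (zcoord_mx A b) *m block_mx (-1)%:M 0 0 1%:M.
  by rewrite mul_row_block !mulmx0 mulmx1 addr0 add0r mul_mx_scalar scaleN1r.
by rewrite det_mulmx det_ublock det1 det_scalar1 mulr1 mulrN1.
Qed.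

(** * Oriented cycles and the chains they support *)

Lemma uniq_map_inj_in (T U : eqType) (f : T -> U) (s : seq T) :
  uniq (map f s) -> {in s &, injective f}.
Proof.
elim: s => //= x s IHs /andP[fx /IHs inj] y z.
rewrite !inE => /predU1P[->|ys] /predU1P[->|zs] // fyz; last exact: inj.
- by case/mapP: fx; exists z.
- by case/mapP: fx; exists y.
Qed.

Section OrientedCycle.

Context {G : graph} (c : seq (dart G)).
Hypothesis c_cycle : oriented_cycle c.

Let c_edges : uniq [seq a.1 | a <- c]. Proof. by case/and4P: c_cycle. Qed.
Let c_srcs : uniq [seq dsrc a | a <- c]. Proof. by case/and4P: c_cycle. Qed.
Let c_uniq : uniq c. Proof. exact: map_uniq c_edges. Qed.
Let edge_inj := uniq_map_inj_in c_edges.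
Let src_inj := uniq_map_inj_in c_srcs.

(** Supplies the length bound built into [is_cycle]. *)
Lemma size_oriented_cycle : (size c <= #|edge G|)%N.
Proof. by rewrite -(size_map fst) -(card_uniqP c_edges) max_card. Qed.

Lemma is_cycle_edges : is_cycle (cycle_edges c).
Proof.
apply/existsP; exists (Bseq size_oriented_cycle).
by rewrite /= c_cycle eqxx.
Qed.

Lemma cycle_vec_dart (a : dart G) : a \in c ->
  cycle_vec c (enum_rank a.1) 0 = (-1) ^+ a.2.
Proof.
move=> ac; rewrite mxE enum_rankK big_mkcond (bigD1_seq a) //= eqxx.
rewrite big1_seq ?addr0 // => d /andP[da dc]; case: eqP => // eq1.
by move: da; rewrite (edge_inj dc ac eq1) eqxx.
Qed.

Lemma cycle_vec_out (i : 'I_#|edge G|) :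
  enum_val i \notin cycle_edges c -> cycle_vec c i 0 = 0.
Proof.
rewrite inE => ic; rewrite mxE big1_seq // => a /andP[/eqP ai ac].
by move: ic; rewrite -ai map_f.
Qed.

(** Exactly one dart of [c] enters and one leaves each vertex of the cycle, so conservation carries
    the same flow from dart to dart. The factor is written as the flow along a dart so that it can
    be evaluated when [w] is itself the chain of a cycle. *)
Lemma chain_cycle_multiple (w : 'cV[int]_#|edge G|) :
  w \in @is_chain_cycle G ->
  (forall i, enum_val i \notin cycle_edges c -> w i 0 = 0) ->
  exists2 a : dart G, a \in c
    & w = ((-1) ^+ a.2 * w (enum_rank a.1) 0) *: cycle_vec c.
Proof.
move=> /eqP dw w_out.
(* The flow of [w] along [a], counted in the direction of traversal. *)
pose f (a : dart G) : int := (-1) ^+ a.2 * w (enum_rank a.1) 0.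
have wE : w = \sum_(a <- c) f a *: ((-1) ^+ a.2 *: delta_mx (enum_rank a.1) 0).
  apply/colP => i; rewrite summxE.
  have [|ic] := boolP (enum_val i \in cycle_edges c).
    rewrite inE => /mapP[a ac ia].
    have {ia}-> : i = enum_rank a.1 by rewrite -ia enum_valK.
    rewrite (bigD1_seq a) //= !mxE !eqxx mulr1 mulrAC -expr2 sqrr_sign mul1r.
    rewrite big1_seq ?addr0 // => d /andP[da dc]; rewrite !mxE.
    case: eqP => [id|]; last by rewrite !mulr0.
    by move: da; rewrite (edge_inj ac dc (enum_rank_inj id)) eqxx.
  rewrite (w_out _ ic) big1_seq // => d /andP[_ dc]; rewrite !mxE.
  case: eqP => [id|]; last by rewrite !mulr0.
  by move: ic; rewrite id enum_rankK inE map_f.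
(* Row [v] of [bd1 G *m w = 0]: inflow equals outflow. *)
have flow v :
    \sum_(a <- c) ((v == dtgt a)%:R * f a) = \sum_(a <- c) ((v == dsrc a)%:R * f a).
  apply/eqP; rewrite -subr_eq0 -sumrB; apply/eqP.
  have /colP/(_ (enum_rank v)) := dw.
  rewrite wE mulmx_sumr summxE => flow0; rewrite -[RHS](etrans flow0) ?mxE //.
  apply: eq_bigr => a _; rewrite -!scalemxAr -colE !mxE !enum_rankK -mulrBl mulrC.
  congr (_ * _); rewrite /dtgt /dsrc.
  by case: a.2; rewrite ?mul1r // expr1 mulN1r opprB.
have dtgt_next a : a \in c -> dtgt a = dsrc (next c a).
  by case/and4P: c_cycle => _ cyc _ _ ac; apply/eqP; exact: (next_cycle cyc).
(* At the head of [a], distinctness of sources leaves [next c a] as the only outgoing dart, and then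
   injectivity of [next c] leaves [a] as the only incoming one. *)
have f_next a : a \in c -> f a = f (next c a).
  move=> ac; have := flow (dtgt a).
  rewrite (bigD1_seq a) //= eqxx mul1r big1_seq ?addr0 => [->|d /andP[da dc]].
    rewrite (bigD1_seq (next c a)) ?mem_next //= dtgt_next // eqxx mul1r.
    rewrite big1_seq ?addr0 // => d /andP[da dc].
    case: eqP => [ad|]; last by rewrite mul0r.
    by move: da; rewrite (src_inj _ _ ad) ?mem_next ?eqxx.
  rewrite !dtgt_next //; case: eqP => [ad|]; last by rewrite mul0r.
  move: da; rewrite -(prev_next c_uniq d) -(src_inj _ _ ad) ?mem_next //.
  by rewrite prev_next ?eqxx.
(* Equality of [f] is transitive, so holding between successors on a closed walk it holds between
   any two darts. *)
have f_const : {in c &, forall a d, f a = f d}.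
  have : cycle [rel a d | f a == f d] c.
    by apply: cycle_from_next => // a /f_next /= ->.
  rewrite cycle_all2rel => [/allrelP cst a d ac dc|]; first exact/eqP/cst.
  by move=> a d e /= /eqP->.
have [x xc] : exists x, x \in c.
  by case: (c) c_cycle => // x s _; exists x; rewrite mem_head.
exists x => //; apply/colP => i; rewrite mxE.
have [|ic] := boolP (enum_val i \in cycle_edges c); last first.
  by rewrite w_out // cycle_vec_out // mulr0.
rewrite inE => /mapP[a ac ia]; rewrite -(enum_valK i) ia cycle_vec_dart //.
by rewrite -/(f x) (f_const x a) // mulrAC -expr2 sqrr_sign mul1r.
Qed.

End OrientedCycle.

Lemma cycle_vec_sign (G : graph) (c c' : seq (dart G)) :
  oriented_cycle c -> oriented_cycle c' -> cycle_edges c = cycle_edges c' ->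
  cycle_vec c = cycle_vec c' \/ cycle_vec c = - cycle_vec c'.
Proof.
move=> c_cycle c'_cycle cc'.
have [|a ac' ->] := chain_cycle_multiple c'_cycle (cycle_vec_Z1 c_cycle).
  by move=> i; rewrite -cc'; apply: cycle_vec_out.
(* The factor is a product of two signs: the directions in which [c] and [c'] traverse the edge of
   [a]. *)
have : a.1 \in cycle_edges c by rewrite cc' inE map_f.
rewrite inE => /mapP[d dc ->]; rewrite cycle_vec_dart // -signr_addb.
by case: (_ (+) _); [right; rewrite scaleN1r | left; rewrite scale1r].
Qed.

(** * Independence of orientations and the harmonic cycle *)

Lemma orientation_choice_sign (G : graph) (zc zc' : {set edge G} -> Z1 G) Y :
  orientation_choice zc -> orientation_choice zc' -> Y \in cycletrees G ->
  zc Y = zc' Y \/ zc Y = - zc' Y.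
Proof.
move=> zcP zc'P Ytree.
have [c [c_cycle cY zE]] := zcP Y Ytree.
have [c' [c'_cycle c'Y z'E]] := zc'P Y Ytree.
(* Both edge sets are the unique cycle of the cycletree [Y]. *)
have cc' : cycle_edges c = cycle_edges c'.
  move: Ytree; rewrite inE => /andP[_ /cards1P[C CE]].
  have in_C d : oriented_cycle d -> cycle_edges d \subset Y -> cycle_edges d = C.
    by move=> dc dY; apply/set1P; rewrite -CE inE is_cycle_edges.
  by rewrite (in_C c) // (in_C c').
have [e|e] := cycle_vec_sign c_cycle c'_cycle cc'; [left | right];
  by apply: val_inj; rewrite /= zE z'E.
Qed.

Theorem corollary4p4p1 (G : graph) (A A' : unicyclization G)
    (b : zbasis (Z1 G) (1 + ncols A)) (b' : zbasis (Z1 G) (1 + ncols A'))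
    (zc zc' : {set edge G} -> Z1 G) :
  connected_graph G ->
  (forall z : 'cV[int]_#|edge G|,
     in_im (unicyclizer A) z <-> in_im (unicyclizer A') z) ->
  orientation_choice zc ->
  orientation_choice zc' ->
  ((forall z : Z1 G, winding b z = winding b' z) \/
   (forall z : Z1 G, winding b z = - winding b' z)) /\
  (harmonic_cycle b zc = harmonic_cycle b' zc' \/
   harmonic_cycle b zc = - harmonic_cycle b' zc').
Proof.
move=> _ imAA' zcP zc'P; have wS := winding_sign b b' imAA'; split => //.
(* Reversing C_Y changes the sign of both the vector and its winding number, so each term is
   unchanged; only the global sign from [wS] remains. *)
have -> : harmonic_cycle b zc = harmonic_cycle b zc'.
  apply: eq_bigr => Y Ytree.
  have [->|->] := orientation_choice_sign zcP zc'P Ytree; first by [].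
  by rewrite windingN mulNrz mulrNz opprK.
case: wS => wE; [left | right]; rewrite /harmonic_cycle -?sumrN;
  by apply: eq_bigr => Y _; rewrite wE ?mulrNz.
Qed.
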